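(* Let $u$ be a primitive word over $\{a,b\}$, let $k\ge 2$ be an integer, and let $w=u^k$. Then $w$ is strongly factor-symmetric if and only if $u$ is a Christoffel word.
   Context: Words are finite words over $\{a,b\}$. A factor of a word $w$ is a contiguous subword (including the empty word and $w$ itself). The Parikh image of a word $x$ is $(|x|_a,|x|_b)$. For a word $w$, $\delta_w(i,j)$ denotes the number of distinct factors of $w$ with Parikh image $(i,j)$. A word $w$ with Parikh image $(p,q)$ is strongly factor-symmetric if $\delta_w(i,j)=\delta_w(p-i,q-j)$ for all $0\le i\le p$, $0\le j\le q$. A word is primitive if it is not equal to $v^m$ for any word $v$ and integer $m\ge2$. A palindrome is a word equal to its reversal. A Christoffel word is either $a$, or $b$, or a word $w=amb$ or $w=bma$ with $m$ a palindrome and $w$ a product of two palindromes. *)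

(* Defs.v *)
From mathcomp Require Import all_boot.

Set Implicit Arguments.
Unset Strict Implicit.
Unset Printing Implicit Defensive.

(* The two letters a and b are the two booleans. *)
Notation word := (seq bool).
Notation letter_a := false.
Notation letter_b := true.

Definition parikh (x : word) : nat * nat :=
  (count_mem letter_a x, count_mem letter_b x).

Lemma size_parikh (x : word) (i j : nat) : parikh x = (i, j) -> size x = i + j.
Proof. by case=> <- <-; elim: x => //= -[] s -> /=; rewrite ?addnS. Qed.

(* delta_w(i, j).  By size_parikh, words with Parikh image (i, j) all have
   length i + j, so that counting distinct factors among (i + j)-tuples misses
   none of them. *)
Definition delta (w : word) (i j : nat) : nat :=
  #|[set x : (i + j).-tuple bool | infix x w & parikh x == (i, j)]|.

Definition strongly_factor_symmetric (w : word) : Prop :=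
  forall i j : nat, i <= (parikh w).1 -> j <= (parikh w).2 ->
    delta w i j = delta w ((parikh w).1 - i) ((parikh w).2 - j).

Definition word_pow (v : word) (m : nat) : word := flatten (nseq m v).

(* The empty word is not primitive, being its own square. *)
Definition primitive (w : word) : Prop :=
  ~ exists (v : word) (m : nat), 2 <= m /\ w = word_pow v m.

Definition palindrome (x : word) : Prop := rev x = x.

Definition palindrome_product (w : word) : Prop :=
  exists x y : word, [/\ palindrome x, palindrome y & w = x ++ y].

Definition christoffel (w : word) : Prop :=
  [\/ w = [:: letter_a],
      w = [:: letter_b] |
      exists m : word,
        [/\ palindrome m,
            w = letter_a :: rcons m letter_b \/ w = letter_b :: rcons m letter_a
          & palindrome_product w]].

(* Main.v *)
(** Let n = |u|.  A factor of w = u^k of length at least n is determined by its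
position modulo n, so the factors of length kn - l with l < n are the l + 1
windows at 0, ..., l, and their complements in the cyclic word are the windows
of length l that straddle the end of w.  Hence w is strongly factor-symmetric
iff, for every l < n, the Parikh images of these straddling windows are those
of the distinct factors of length l, with multiplicities.

If u = a s b is a Christoffel word, so that b s a is conjugate to u, the
straddling windows are pairwise distinct and exhaust the factors of length l.
Conversely, symmetry gives l + 1 factors of each length l < n, which forces u
to be conjugate to some a s b and b s a with s a palindrome.  The windows
straddling the end of a s b also enumerate the factors, so for every l they
contain as many letters b as those straddling the end of u; second differences
in l then show that u_t + u_(n-1-t) is the same for u as for a s b, whence
u = a s b or u = b s a. *)
Require Import Defs.
From mathcomp Require Import all_boot.
From mathcomp Require Import zify.

Set Implicit Arguments.
Unset Strict Implicit.
Unset Printing Implicit Defensive.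

Implicit Types (u v w x y s : word) (c d i j k l n t : nat).

(** * Cyclic windows of a word *)

Definition per u i : bool := nth letter_a u (i %% size u).

Definition window u i l : word := [seq per u r | r <- iota i l].

Lemma size_window u i l : size (window u i l) = l.
Proof. by rewrite size_map size_iota. Qed.

Lemma windowD u i l1 l2 :
  window u i (l1 + l2) = window u i l1 ++ window u (i + l1) l2.
Proof. by rewrite /window iotaD map_cat. Qed.

Lemma windowS u i l : window u i l.+1 = per u i :: window u i.+1 l.
Proof. by []. Qed.

Lemma windowSr u i l : window u i l.+1 = rcons (window u i l) (per u (i + l)).
Proof. by rewrite -addn1 windowD cats1. Qed.

Lemma nth_window u i l r : r < l -> nth letter_a (window u i l) r = per u (i + r).
Proof. by move=> lt_rl; rewrite (nth_map 0) ?size_iota // nth_iota. Qed.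

Lemma perDn u i : per u (i + size u) = per u i.
Proof. by rewrite /per modnDr. Qed.

Lemma perDMn u i k : per u (i + k * size u) = per u i.
Proof. by rewrite addnC /per modnMDl. Qed.

Lemma eq_window u i j l :
  (forall r, r < l -> per u (i + r) = per u (j + r)) -> window u i l = window u j l.
Proof.
move=> eq_ij; apply: (@eq_from_nth _ letter_a); rewrite ?size_window // => r lt_rl.
by rewrite !nth_window // eq_ij.
Qed.

Lemma window_per u i j l r :
  window u i l = window u j l -> r < l -> per u (i + r) = per u (j + r).
Proof. by move=> eq_ij lt_rl; rewrite -!(@nth_window u _ l) // eq_ij. Qed.

Lemma window_sub u i j l r l' : r + l' <= l ->
  window u i l = window u j l -> window u (i + r) l' = window u (j + r) l'.
Proof.
move=> le_l eq_ij; apply: eq_window => t lt_t; rewrite -!addnA.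
by apply: window_per eq_ij _; lia.
Qed.

Lemma windowDMn u i l k : window u (i + k * size u) l = window u i l.
Proof. by apply: eq_window => r _; rewrite addnAC perDMn. Qed.

Lemma window_modn u i l : window u (i %% size u) l = window u i l.
Proof. by rewrite [in RHS](divn_eq i (size u)) addnC windowDMn. Qed.

Lemma window_mod u i j l : i = j %[mod size u] -> window u i l = window u j l.
Proof. by move=> eq_ij; rewrite -window_modn eq_ij window_modn. Qed.

Lemma size_word_pow v k : size (word_pow v k) = k * size v.
Proof. by elim: k => //= k IHk; rewrite /word_pow /= size_cat IHk mulSn. Qed.

Lemma window0_id u : window u 0 (size u) = u.
Proof.
apply: (@eq_from_nth _ letter_a); rewrite size_window // => r lt_r.
by rewrite nth_window // /per modn_small.
Qed.

Lemma word_powE u k : word_pow u k = window u 0 (k * size u).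
Proof.
elim: k => [|k IHk]; first by rewrite mul0n.
rewrite mulSn windowD window0_id /word_pow /= -/(word_pow u k) IHk.
by rewrite -[size u]mul1n windowDMn mul1n.
Qed.

Lemma infix_windowP u i n x l :
  reflect (exists2 t, t + l <= n & x = window u (i + t) l)
    ((size x == l) && infix x (window u i n)).
Proof.
apply: (iffP andP) => [[/eqP <- /infixP [p [s def_w]]]|[t le_n ->]].
  have def_n : n = size p + size x + size s.
    by rewrite -(size_window u i n) def_w !size_cat addnA.
  exists (size p); first by rewrite def_n; lia.
  move: def_w; rewrite def_n !windowD -catA => /eqP.
  rewrite eqseq_cat ?size_window // => /andP [_].
  by rewrite eqseq_cat ?size_window // => /andP [/eqP].
rewrite size_window eqxx; split=> //; apply/infixP.
exists (window u i t), (window u (i + t + l) (n - (t + l))).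
by rewrite catA -windowD -addnA -windowD subnKC.
Qed.

Lemma count_window u (a : pred bool) i k :
  count a (window u i (k * size u)) = count a (word_pow u k).
Proof.
rewrite word_powE; elim: i => // i <-.
set N := k * _; apply: (@addnI (a (per u i))).
rewrite -[LHS]/(count a (window u i N.+1)) windowSr -cats1 count_cat /= addn0.
by rewrite perDMn addnC.
Qed.

(** * Primitivity and windows of full length *)

Lemma primitive_gt0 u : primitive u -> 0 < size u.
Proof. by case: u => // [[]]; exists [::], 2. Qed.

(* Comparing with a Bezout relation turns a shift by d into a period gcd(d, n)
   of the cyclic word. *)
Lemma primitive_window_inj u i j : primitive u ->
  window u i (size u) = window u j (size u) -> i = j %[mod size u].
Proof.
move=> prim_u; have n_gt0 := primitive_gt0 prim_u; set n := size u in n_gt0 *.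
wlog le_ij : i j / i <= j => [IH eq_w|].
  by case/orP: (leq_total i j) => /IH => [|H]; [apply | apply/esym/H].
move=> eq_w; apply/eqP; rewrite eq_sym eqn_mod_dvd //; set d := j - i.
have [->|d_gt0] := posnP d; first exact: dvdn0.
have per_d r : per u (r + d) = per u r.
  have per_ij t : per u (i + t) = per u (j + t).
    have lt_t : t %% n < n by rewrite ltn_mod.
    rewrite (divn_eq t n) [_ * n + _]addnC !addnA !perDMn.
    exact: window_per eq_w lt_t.
  (* Adding [i * n] lifts the position to at least [i], where [per_ij] applies. *)
  rewrite -(perDMn _ r i) -(perDMn _ (r + d) i).
  have le_in : i <= i * n by rewrite leq_pmulr.
  have -> : r + i * n = i + (r + (i * n - i)) by lia.
  rewrite per_ij; congr per; rewrite /d; lia.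
have per_dM r m : per u (r + m * d) = per u r.
  by elim: m => [|m IHm]; rewrite ?addn0 // mulSnr addnA per_d.
set g := gcdn d n.
have per_g r : per u (r + g) = per u r.
  case: (egcdnP n d_gt0) => km kn eq_g _.
  by rewrite -(perDMn _ _ kn) -(per_dM r km) eq_g -addnA [g + _]addnC.
have per_gM r m : per u (r + m * g) = per u r.
  by elim: m => [|m IHm]; rewrite ?addn0 // mulSnr addnA per_g.
have g_gt0 : 0 < g by rewrite gcdn_gt0 d_gt0.
have /dvdnP [m def_n] : g %| n by rewrite dvdn_gcdr.
(* Now [u] is the [m]-th power of its prefix of length [g]; primitivity forces [m = 1], and then
   [n = g] divides [d]. *)
have [m_gt1 | m_le1] := ltnP 1 m; last first.
  have m1 : m = 1 by move: n_gt0; rewrite def_n; case: m m_le1 def_n => [|[]].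
  by rewrite def_n m1 mul1n dvdn_gcdl.
case: prim_u; exists (take g u), m; split=> //.
have le_gn : g <= n by rewrite def_n leq_pmull // ltnW.
have size_g : size (take g u) = g by rewrite size_takel.
rewrite word_powE size_g -def_n -[LHS]window0_id.
apply: (@eq_from_nth _ letter_a); rewrite !size_window // => r lt_r.
rewrite !nth_window // !add0n [RHS]/per size_g nth_take ?ltn_mod //.
rewrite [in LHS](divn_eq r g) addnC per_gM /per modn_small //.
by rewrite (leq_trans _ le_gn) // ltn_mod.
Qed.

(** * Counting factors by windows *)

Lemma delta_count w i j (s : seq word) : uniq s ->
    (forall x, (x \in s) = (size x == i + j) && infix x w) ->
  delta w i j = count (fun x => parikh x == (i, j)) s.
Proof.
move=> uniq_s mem_s; rewrite /delta cardE -(size_map val) -size_filter.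
apply/perm_size/uniq_perm.
- by rewrite map_inj_uniq ?enum_uniq //; apply: val_inj.
- exact: filter_uniq.
move=> x; rewrite mem_filter mem_s; apply/mapP/and3P => [[t]|[px sx ix]].
  by rewrite mem_enum inE => /andP [it pt] ->; rewrite size_tuple.
by exists (Tuple sx); rewrite // mem_enum inE /= ix.
Qed.

Lemma window_coverP u k x l : 0 < size u -> l <= k * size u ->
  reflect (exists2 t, t <= minn (k * size u - l) (size u).-1 & x = window u t l)
    ((size x == l) && infix x (word_pow u k)).
Proof.
move=> n_gt0 le_l; rewrite word_powE.
apply: (iffP (infix_windowP _ _ _ _ _)) => [[t le_t ->]|[t le_t ->]].
  exists (t %% size u); last by rewrite window_modn.
  have := leq_mod t (size u); have := ltn_pmod t n_gt0; lia.
by exists t => //; lia.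
Qed.

(** The two windows make up [k] full turns, whose letter counts do not depend on the start. *)
Lemma parikh_window u k i l : l <= k * size u ->
  (parikh (word_pow u k)).1 =
    (parikh (window u i l)).1 + (parikh (window u (i + l) (k * size u - l))).1 /\
  (parikh (word_pow u k)).2 =
    (parikh (window u i l)).2 + (parikh (window u (i + l) (k * size u - l))).2.
Proof.
move=> le_l; rewrite /= -!(count_window _ _ i) -(subnKC le_l) windowD.
by rewrite !count_cat addKn.
Qed.

(* Long factors are determined by their position modulo [size u], and each is
   counted through its complement in the cyclic word. *)
Lemma delta_long u k i j : primitive u ->
    i <= (parikh (word_pow u k)).1 -> j <= (parikh (word_pow u k)).2 ->
    size u <= i + j ->
  delta (word_pow u k) i j =
    count (fun x => parikh x ==
             ((parikh (word_pow u k)).1 - i, (parikh (word_pow u k)).2 - j))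
      [seq window u (t + (i + j)) (k * size u - (i + j))
        | t <- iota 0 (minn (k * size u - (i + j)) (size u).-1).+1].
Proof.
move=> prim_u le_i le_j le_n; have n_gt0 := primitive_gt0 prim_u.
have le_l : i + j <= k * size u.
  rewrite -size_word_pow (@size_parikh _ (parikh (word_pow u k)).1 (parikh (word_pow u k)).2) //.
  exact: leq_add.
set M := minn _ _.
rewrite (@delta_count _ _ _ [seq window u t (i + j) | t <- iota 0 M.+1]).
- rewrite !count_map; apply: eq_count => t /=.
  case: (parikh_window t le_l) => eq1 eq2.
  have := @size_parikh (window u t (i + j)) _ _ erefl.
  rewrite size_window -!pair_eqE /pair_eq.
  move: le_i le_j eq1 eq2 => /=; lia.
- rewrite map_inj_in_uniq ?iota_uniq // => t1 t2.
  rewrite !mem_iota /= !add0n => lt_t1 lt_t2 eq_w.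
  have := @window_sub _ _ _ _ 0 _ le_n eq_w; rewrite !addn0.
  move/(primitive_window_inj prim_u); rewrite !modn_small //; lia.
move=> x; apply/mapP/(window_coverP _ n_gt0 le_l) => -[t].
  by rewrite mem_iota => lt_t ->; exists t.
by move=> lt_t ->; exists t; rewrite ?mem_iota.
Qed.

(** * Windows straddling a boundary *)

Lemma window_residue u c i l : 0 < size u ->
  exists2 t, c <= t < c + size u & window u i l = window u t l.
Proof.
move=> n_gt0; set r := i + c * (size u).-1.
exists (c + r %% size u); first by have := ltn_pmod r n_gt0; lia.
apply: window_mod; rewrite modnDmr.
have -> : c + r = c * size u + i by rewrite /r; nia.
by rewrite modnMDl.
Qed.

(* Downward induction on l.  A factor v of length l missed by the windows
   straddling c + n would have to be the one just after c, so it is also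
   preceded by the letter at c'; that longer factor straddles c + n by
   induction, and not at its first letter, whence v straddles c + n too. *)
Lemma straddle_cover u c c' i l :
    per u c != per u c' ->
    window u c.+1 (size u - 2) = window u c'.+1 (size u - 2) ->
    l < size u ->
  exists2 t, c + size u - l <= t <= c + size u & window u i l = window u t l.
Proof.
set n := size u => neq_cc' eq_w lt_l; have n_gt0 : 0 < n by lia.
have le_l : l <= n.-1 by lia.
rewrite -(subKn le_l); move: (_ - l) => {le_l lt_l l} m.
elim: m i => [|m IHm] i.
  (* For length [n - 1] the allowed starts [c + 1, ..., c + n] meet every residue. *)
  have [t t_in ->] := window_residue c.+1 i (n.-1 - 0) n_gt0.
  by exists t => //; move: t_in; rewrite -/n; lia.
have [le_m|lt_m] := leqP n.-1 m.
  have -> : n.-1 - m.+1 = n.-1 - m by lia.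
  exact: IHm.
set l := n.-1 - m.+1; have def_l : n.-1 - m = l.+1 by rewrite /l; lia.
rewrite def_l in IHm.
(* Position [i + n.-1] stands for [i - 1]: the factor is extended by the letter before it. *)
have [t t_in] := IHm (i + n.-1).
rewrite !windowS => -[_]; rewrite -addnS prednK //.
rewrite -[n in i + n]mul1n windowDMn => ->.
have [le_t|lt_t] := leqP t.+1 (c + n); first by exists t.+1 => //; lia.
have -> : t = c + 1 * n by lia.
rewrite -[_.+1]/(c.+1 + 1 * n) windowDMn.
have [t' t'_in] := IHm c'.
rewrite !windowS => -[eq_t'].
have [le_t' | lt_t'] := leqP t'.+1 (c + n); last first.
  have def_t' : t' = c + n by lia.
  by case/eqP: neq_cc'; rewrite eq_t' def_t' perDn.
move=> eq_wt'; exists t'.+1; first by lia.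
rewrite -eq_wt'.
have le_ln : 0 + l <= n - 2 by lia.
by have := window_sub le_ln eq_w; rewrite !addn0.
Qed.

(* Upward induction on l: dropping a letter at either end reduces to shorter
   windows, unless a prefix of the word at c equals a suffix of it, which the
   palindrome excludes. *)
Lemma straddle_inj u c l t t' :
    (1 < size u -> per u c != per u (c + (size u).-1)) ->
    (forall r, 0 < r < (size u).-1 -> per u (c + r) = per u (c + (size u).-1 - r)) ->
    l < size u ->
    c + size u - l <= t <= c + size u -> c + size u - l <= t' <= c + size u ->
  window u t l = window u t' l -> t = t'.
Proof.
set n := size u => neq_c pal_c.
elim: l t t' => [|l IHl] t t' lt_l; first by lia.
wlog le_t : t t' / t <= t'.
  move=> IH t_in t'_in eq_w; case/orP: (leq_total t t') => le_t; first exact: IH.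
  exact/esym/IH.
move=> t_in t'_in eq_w.
have [lt_t'|le_t'] := ltnP t' (c + n).
  by apply/succn_inj/IHl; [lia..|move: eq_w; rewrite !windowS => -[]].
have [lt_t|le_t2] := ltnP (c + n - l.+1) t.
  apply: IHl; [lia..|].
  by move: eq_w; rewrite !windowSr => /rcons_inj [].
(* The windows left are the prefix and the suffix of length [l + 1] of the word at [c]. Comparing
   their first and last letters and reflecting position [l] makes the two end letters of that word
   equal. *)
have def_t' : t' = c + n by lia.
have def_t : t = c + n - l.+1 by lia.
case/eqP: (neq_c ltac:(lia)).
have := window_per eq_w (ltn0Sn l); rewrite !addn0 def_t' perDn => eq_first.
have := window_per eq_w (ltnSn l); rewrite def_t' addnAC perDn.
have -> : t + l = c + n.-1 by lia.
move=> ->; have [->|l_gt0] := posnP l; first by rewrite addn0.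
by rewrite -eq_first pal_c; [congr per; lia|lia].
Qed.

(** * Palindromes and conjugates *)

(** Euclid's algorithm on the lengths: if [x = a :: x'] is the shorter word, the equations force
    [y = b :: x' ++ z], and unless both words are single letters the pair [x], [z] satisfies them
    with a shorter [s]. *)
Lemma conjugate_palindromes x y s (a b : bool) : a != b ->
  x ++ y = a :: rcons s b -> y ++ x = b :: rcons s a -> palindrome x /\ palindrome y.
Proof.
have [m] := ubnP (size x + size y).
elim: m x y s a b => // m IHm x y s a b.
wlog le_xy : x y a b / size x <= size y => [IH lt_m neq_ab eq_xy eq_yx|].
  case/orP: (leq_total (size x) (size y)) => le_xy; first exact: IH eq_xy eq_yx.
  by case: (IH y x b a) => //; rewrite 1?addnC // eq_sym.
rewrite ltnS; case: x le_xy => [|a' x'] le_xy lt_m neq_ab.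
  by rewrite cats0 /= => -> [] eq_ab; rewrite eq_ab eqxx in neq_ab.
case: y le_xy lt_m => // b' y' /= le_xy lt_m [-> eq_xy] [def_b' eq_yx].
rewrite {b'}def_b' in eq_xy *.
have size_s : size s = size x' + size y'.
  by have := congr1 size eq_xy; rewrite size_cat size_rcons /=; lia.
have def_x' : x' = take (size x') s.
  by have := congr1 (take (size x')) eq_xy; rewrite take_size_cat // -cats1 takel_cat //; lia.
have [z def_y'] : exists z, y' = x' ++ z.
  exists (drop (size x') y'); rewrite -[LHS](cat_take_drop (size x')).
  congr (_ ++ _); have := congr1 (take (size x')) eq_yx.
  rewrite -cats1 !takel_cat // -?def_x' //; lia.
have [t def_s] : exists t : word, s = x' ++ t.
  by exists (drop (size x') s); rewrite [in X in X ++ _]def_x' cat_take_drop.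
move: eq_xy eq_yx; rewrite def_y' def_s -catA !rcons_cat.
move=> /eqP; rewrite eqseq_cat // => /andP [_ /eqP eq_b].
move=> /eqP; rewrite eqseq_cat // => /andP [_ /eqP eq_a].
case: t eq_b eq_a {def_s} => [|b'' s'] /=.
  by case: (x') => //; case: (z).
move=> [<- eq_b] eq_a.
have [|||pal_x pal_z] := IHm (a :: x') z s' a b _ neq_ab.
- by move: lt_m; rewrite def_y' size_cat /=; lia.
- by rewrite /= eq_b.
- by rewrite eq_a.
split=> //; rewrite /palindrome rev_cons rev_cat pal_z.
(* Reversing [x] in [z ++ x] gives [z ++ rev x' = b :: s'], whence [rev y = y]. *)
move: eq_a; rewrite -{1}pal_x rev_cons -rcons_cat -rcons_cons.
move=> /rcons_inj [eq_a].
by rewrite eq_a rcons_cons -eq_b.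
Qed.

Lemma windowSS u c l :
  window u c l.+2 = per u c :: rcons (window u c.+1 l) (per u (c + l.+1)).
Proof. by rewrite windowS windowSr addSnnS. Qed.

Lemma window_ends u c l (a b : bool) s :
  window u c l.+2 = a :: rcons s b ->
  [/\ per u c = a, per u (c + l.+1) = b & window u c.+1 l = s].
Proof.
by rewrite windowSS => -[-> /rcons_inj [-> ->]].
Qed.

Lemma palindrome_per u c l :
  palindrome (window u c.+1 l) ->
  forall r, 0 < r < l.+1 -> per u (c + r) = per u (c + l.+1 - r).
Proof.
move=> pal_w r r_in.
have [-> ->] : c + r = c.+1 + r.-1 /\ c + l.+1 - r = c.+1 + (l - r) by lia.
rewrite -!(@nth_window u c.+1 l); [|lia..].
rewrite -{1}pal_w nth_rev size_window; last by lia.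
by rewrite prednK //; case/andP: r_in.
Qed.

(** If [u = x ++ y] with both palindromes, the conjugate [y ++ x] at [size x] is the reversal of
    [u]. *)
Lemma christoffel_conjugate u : christoffel u -> 1 < size u ->
  exists s (a b : bool) c',
    [/\ a != b, palindrome s, u = a :: rcons s b
      & window u c' (size u) = b :: rcons s a].
Proof.
case=> [->|->|[m [pal_m def_u [x [y [pal_x pal_y def_xy]]]]]] //.
have [a [b [neq_ab {}def_u]]] : exists a b, a != b /\ u = a :: rcons m b.
  by case: def_u => ->; [exists letter_a, letter_b | exists letter_b, letter_a].
exists m, a, b, (size x); split=> //.
have rot_u : window u (size x) (size u) = y ++ x.
  have /eqP : window u 0 (size x) ++ window u (0 + size x) (size y) = x ++ y.
    by rewrite -windowD -size_cat -def_xy window0_id.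
  rewrite eqseq_cat ?size_window // => /andP [/eqP def_x /eqP def_y].
  have -> : size u = size y + size x by rewrite def_xy size_cat addnC.
  rewrite windowD def_y; congr (_ ++ _).
  by rewrite -size_cat -def_xy -[size u]mul1n -[1 * _]add0n windowDMn.
rewrite rot_u -{1}pal_x -{1}pal_y -rev_cat -def_xy def_u.
by rewrite rev_cons rev_rcons pal_m.
Qed.

(* As in delta_long, the window at t + (k * size u - l) is the complement, in the
   cyclic word u ^ k, of the window at t. *)
Lemma christoffel_straddle u k l : primitive u -> christoffel u -> l <= k * size u ->
  let starts := iota 0 (minn l (size u).-1).+1 in
  let windows := [seq window u (t + (k * size u - l)) l | t <- starts] in
  uniq windows /\
  (forall i, window u i l \in windows).
Proof.
move=> prim_u chr_u le_l; have n_gt0 := primitive_gt0 prim_u.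
set n := size u in n_gt0 le_l *; move=> starts windows.
have [le_nl | lt_ln] := leqP n l.
  have def_M : minn l n.-1 = n.-1 by lia.
  rewrite /windows /starts def_M prednK //; split.
    rewrite map_inj_in_uniq ?iota_uniq // => t1 t2.
    rewrite !mem_iota /= !add0n => lt_t1 lt_t2 eq_w.
    have := @window_sub _ _ _ _ 0 _ le_nl eq_w; rewrite !addn0.
    move/(primitive_window_inj prim_u)/eqP; rewrite eqn_modDr.
    by rewrite !modn_small // => /eqP.
  move=> i; have [t t_in ->] := window_residue (k * n - l) i l n_gt0.
  apply/mapP; exists (t - (k * n - l)); first by rewrite mem_iota; move: t_in; rewrite -/n; lia.
  by rewrite subnK //; case/andP: t_in.
have def_M : minn l n.-1 = l by lia.
have [l0|l_gt0] := posnP l; first by rewrite /windows /starts l0 min0n.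
have n_gt1 : 1 < n by lia.
have [s [a [b [c' [neq_ab pal_s def_u def_c']]]]] := christoffel_conjugate chr_u n_gt1.
set m := n - 2; have def_n : n = m.+2 by lia.
(* The last copy of [u] starts at [c], so [c + n] is the end of the power. *)
set c := k.-1 * n; have def_c : c + n = k * n.
  by rewrite -mulSnr prednK //; case: (k) le_l => //; lia.
have [uc uc1 ws] : [/\ per u c = a, per u (c + m.+1) = b & window u c.+1 m = s].
  by apply: window_ends; rewrite -def_n -[c]add0n windowDMn window0_id.
have [uc' _ ws'] : [/\ per u c' = b, per u (c' + m.+1) = a & window u c'.+1 m = s].
  by apply: window_ends; rewrite -def_n.
rewrite /windows /starts def_M -def_c; split.
  rewrite map_inj_in_uniq ?iota_uniq // => t1 t2; rewrite !mem_iota !add0n => lt_t1 lt_t2.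
  move/(@straddle_inj u c l) => inj; apply: (@addIn (c + n - l)); apply: inj; rewrite -/n.
  - by move=> _; rewrite def_n uc uc1.
  - by rewrite def_n; apply: palindrome_per; rewrite ws.
  - by [].
  - by lia.
  - by lia.
move=> i; have [||t t_in ->] := @straddle_cover u c c' i l _ _ lt_ln.
- by rewrite uc uc'.
- by rewrite -/n -/m ws ws'.
apply/mapP; exists (t - (c + n - l)); first by rewrite mem_iota; move: t_in; rewrite -/n; lia.
by rewrite subnK //; case/andP: t_in.
Qed.

(** * Powers of Christoffel words are symmetric *)

Lemma christoffel_sfs u k : primitive u -> 2 <= k -> christoffel u ->
  strongly_factor_symmetric (word_pow u k).
Proof.
move=> prim_u k_ge2 chr_u; have n_gt0 := primitive_gt0 prim_u.
set w := word_pow u k; set p := (parikh w).1; set q := (parikh w).2.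
have def_pq : p + q = k * size u.
  by rewrite -size_word_pow (@size_parikh w p q).
(* As [k >= 2], [(i, j)] or its complement has length at least [size u], and the equation is
   symmetric in the two. *)
suff half i j : i <= p -> j <= q -> size u <= i + j ->
    delta w i j = delta w (p - i) (q - j).
  move=> i j le_i le_j; have [|lt_n] := leqP (size u) (i + j); first exact: half.
  by rewrite (half (p - i) (q - j)) ?leq_subr // ?subKn //; nia.
move=> le_i le_j le_n; rewrite delta_long //.
have [|uniq_s mem_s] := @christoffel_straddle u k (k * size u - (i + j)) prim_u chr_u.
  exact: leq_subr.
have le_l : i + j <= k * size u by rewrite -def_pq leq_add.
rewrite subKn // in uniq_s mem_s; apply/esym/delta_count => // x.
have def_l : p - i + (q - j) = k * size u - (i + j) by lia.
rewrite def_l; apply/idP/(window_coverP _ n_gt0 (leq_subr _ _)) => [|[t _ -> //]].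
case/mapP => t; rewrite subKn // mem_iota => t_in ->.
set l := _ - (i + j).
have [t' t'_in ->] := window_residue 0 (t + (i + j)) l n_gt0.
by exists t' => //; lia.
Qed.

(** * Symmetric powers come from Christoffel words *)

(** Meant for [l <= e]: the starts run from [e - l], where the window ends just before [e], to [e]
    itself. *)
Definition straddle u e l : seq word :=
  [seq window u (t + (e - l)) l | t <- iota 0 l.+1].

Definition cyclic_factors u l : seq word :=
  undup [seq window u t l | t <- iota 0 (size u)].

(** Long factors are counted through their complements, so symmetry equates counts over short
    factors with counts over the windows straddling the end of the power. *)
Lemma sfs_straddle u k l : primitive u -> 2 <= k ->
    strongly_factor_symmetric (word_pow u k) -> l < size u ->
  perm_eq (map parikh (cyclic_factors u l)) (map parikh (straddle u (k * size u) l)).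
Proof.
move=> prim_u k_ge2 sfs_w lt_l; have n_gt0 := primitive_gt0 prim_u.
have le_nk : 2 * size u <= k * size u by rewrite leq_mul2r k_ge2 orbT.
set w := word_pow u k in sfs_w *; set p := (parikh w).1 in sfs_w; set q := (parikh w).2 in sfs_w.
have def_pq : p + q = k * size u.
  by rewrite -size_word_pow (@size_parikh w p q).
rewrite /perm_eq -map_cat; apply/allP => _ /mapP [x x_in ->] /=.
have {x_in} [t def_x] : exists t, x = window u t l.
  move: x_in; rewrite mem_cat mem_undup => /orP [] /mapP [t _ ->]; first by exists t.
  by exists (t + (k * size u - l)).
have le_l : l <= k * size u by lia.
have [le_i le_j] : (parikh x).1 <= p /\ (parikh x).2 <= q.
  by case: (parikh_window t le_l); rewrite -def_x -/w -/p -/q; lia.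
have : (parikh x).1 + (parikh x).2 = l.
  by rewrite -(@size_parikh x _ _ erefl) def_x size_window.
case: (parikh x) le_i le_j => i j /= le_i le_j def_l {x t def_x}.
rewrite !count_map; apply/eqP; transitivity (delta w i j).
  apply/esym/delta_count => [|x]; first exact: undup_uniq.
  rewrite def_l mem_undup; apply/mapP/(window_coverP _ n_gt0 le_l) => -[t t_in ->].
    by exists t => //; rewrite mem_iota in t_in; lia.
  by exists t => //; rewrite mem_iota; lia.
rewrite sfs_w // delta_long ?leq_subr -/w -/p -/q //; last by lia.
rewrite !subKn // count_map; have -> : p - i + (q - j) = k * size u - l by lia.
have -> : k * size u - (k * size u - l) = l by lia.
have -> : minn l (size u).-1 = l by lia.
by [].
Qed.

(** Cutting each window at [e] leaves a part ending there and a part starting there; over all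
    windows, each length from 0 to [l] occurs once on either side. *)
Lemma sumn_straddle u e l : l <= e ->
  sumn (map snd (map parikh (straddle u e l))) =
    \sum_(0 <= t < l.+1)
      ((parikh (window u (e - t) t)).2 + (parikh (window u e t)).2).
Proof.
move=> le_l; rewrite big_split big_nat_rev -big_split sumnE !big_map.
rewrite /index_iota subn0 [LHS]big_seq [RHS]big_seq; apply: eq_bigr => t.
rewrite mem_iota !add0n subSS => /= lt_t.
rewrite -count_cat; set i := e - (l - t).
have -> : t + (e - l) = i by rewrite /i; lia.
have -> : window u e t = window u (i + (l - t)) t by congr window; rewrite /i; lia.
by rewrite -windowD subnK //; lia.
Qed.

(** The first difference in [l] of the sums is [F e l], the count in the two windows of length [l]
    adjacent to [e]; the second difference leaves one letter on each side of [e]. *)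
Lemma straddle_sums_eq u e1 e2 n : n <= e1 -> n <= e2 ->
    (forall l, l < n -> sumn (map snd (map parikh (straddle u e1 l))) =
      sumn (map snd (map parikh (straddle u e2 l)))) ->
  forall t, t.+1 < n ->
    per u (e1 - t.+1) + per u (e1 + t) = per u (e2 - t.+1) + per u (e2 + t) :> nat.
Proof.
move=> le_e1 le_e2 eq_sums.
pose F e t := (parikh (window u (e - t) t)).2 + (parikh (window u e t)).2.
have FS e t : t < e -> F e t.+1 = F e t + (per u (e - t.+1) + per u (e + t)).
  move=> lt_te; rewrite /F windowS windowSr -cats1 /= count_cat /= -subSn // subSS.
  rewrite !eqb_id; lia.
have eqF t : t < n -> F e1 t = F e2 t.
  case: t => [|t] lt_t; first by [].
  have := eq_sums t.+1 lt_t; rewrite !sumn_straddle; [|lia..].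
  rewrite !(big_nat_recr t.+1) //= -!sumn_straddle; [|lia..].
  by rewrite eq_sums; [move/addnI|lia].
move=> t lt_t; have := eqF _ lt_t; rewrite !FS; [|lia..].
by rewrite eqF; [move/addnI|lia].
Qed.

(* s is the factor of length |u| - 2 that occurs twice in the cyclic word. *)
Lemma sfs_conjugates u n : size u = n.+2 ->
    (forall l, l < size u -> size (cyclic_factors u l) = l.+1) ->
  exists c d s (a b : bool),
    [/\ d < size u, a != b, window u c (size u) = a :: rcons s b
      & window u (c + d) (size u) = b :: rcons s a].
Proof.
move=> size_u sizeF.
(* There are [n + 2] starts but only [n + 1] distinct factors of length [n]. *)
have : ~~ uniq [seq window u t n | t <- iota 0 (size u)].
  apply/negP => /undup_id eqF; have := sizeF n ltac:(lia).
  by rewrite /cyclic_factors eqF size_map size_iota; lia.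
case/(uniqPn [::]) => i [j []]; rewrite size_map size_iota => lt_ij lt_j.
rewrite !(nth_map 0) ?size_iota; [|lia..]; rewrite !nth_iota; [|lia..].
rewrite !add0n => eq_w.
(* Modulo [size u], [c] is [i - 1] and [c + d] is [j - 1]. The letters there differ, since windows
   of length [n + 1] are distinct at distinct residues. *)
set c := i + n.+1; set d := j - i; have def_cd : c + d = j + n.+1 by rewrite /c /d; lia.
have eq_s : window u (c + d).+1 n = window u c.+1 n.
  rewrite def_cd /c -!addnS -size_u -[size u]mul1n.
  by rewrite !windowDMn.
have neq_a : per u c != per u (c + d).
  apply/negP => /eqP eq_a.
  have uniqF : uniq [seq window u t n.+1 | t <- iota 0 (size u)].
    rewrite -[uniq _]negbK -ltn_size_undup -/(cyclic_factors u n.+1) sizeF; last by lia.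
    by rewrite size_map size_iota size_u ltnn.
  have : c %% size u = (c + d) %% size u.
    apply/eqP; rewrite -(nth_uniq [::] _ _ uniqF) ?size_map ?size_iota ?ltn_mod; [|lia..].
    rewrite !(nth_map 0) ?size_iota ?ltn_mod ?nth_iota ?ltn_mod; [|lia..].
    by rewrite !add0n !window_modn !windowS eq_a eq_s.
  rewrite def_cd /c => /eqP; rewrite eqn_modDr !modn_small; lia.
(* Full turns contain equally many letters [b]; as the first letters differ, the last ones are the
   same two in the other order. *)
have eq_count : count_mem letter_b (window u c (size u)) =
    count_mem letter_b (window u (c + d) (size u)).
  by rewrite -[size u]mul1n !count_window.
exists c, d, (window u c.+1 n), (per u c), (per u (c + d)).
move: eq_count; rewrite size_u !windowSS eq_s -!cats1 /= !count_cat /=.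
move=> eq_count; split=> //; first by lia.
  congr (_ :: _ ++ [:: _]); move: eq_count neq_a.
  by do 4!case: (per u _); lia.
congr (_ :: _ ++ [:: _]); move: eq_count neq_a.
by do 4!case: (per u _); lia.
Qed.

Lemma sfs_christoffel u k : primitive u -> 2 <= k ->
  strongly_factor_symmetric (word_pow u k) -> christoffel u.
Proof.
move=> prim_u k_ge2 sfs_w; have n_gt0 := primitive_gt0 prim_u.
have permF l := @sfs_straddle u k l prim_u k_ge2 sfs_w.
have sizeF l : l < size u -> size (cyclic_factors u l) = l.+1.
  by move/permF/perm_size; rewrite !size_map size_iota.
have [n1|[n size_u]] : size u = 1 \/ exists n, size u = n.+2.
  by case: (size u) n_gt0 => [|[|n]] // _; [left | right; exists n].
  by case: (u) n1 => [|[] []] // _; [apply: Or32 | apply: Or31].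
have [c [d [s [a [b [lt_d neq_ab def_v def_v']]]]]] := sfs_conjugates size_u sizeF.
have [va vb vs] : [/\ per u c = a, per u (c + n.+1) = b & window u c.+1 n = s].
  by apply: window_ends; rewrite -size_u.
have [va' vb' vs'] : [/\ per u (c + d) = b, per u (c + d + n.+1) = a & window u (c + d).+1 n = s].
  by apply: window_ends; rewrite -size_u.
set x := window u c d; set y := window u (c + d) (size u - d).
have def_xy : x ++ y = a :: rcons s b by rewrite -def_v -windowD subnKC // ltnW.
have def_yx : y ++ x = b :: rcons s a.
  rewrite -def_v' /x -[d in window u c d](subKn (ltnW lt_d)).
  rewrite -(windowDMn u c _ 1).
  have -> : c + 1 * size u = c + d + (size u - d) by lia.
  by rewrite -windowD subnKC // leq_subr.
have [pal_x pal_y] := conjugate_palindromes neq_ab def_xy def_yx.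
have pal_s : palindrome s.
  have := rev_cat x y; rewrite pal_x pal_y def_xy def_yx rev_cons rev_rcons.
  by rewrite rcons_cons => -[/rcons_inj []].
have sums l : l < size u ->
    sumn (map snd (map parikh (straddle u (k * size u) l))) =
    sumn (map snd (map parikh (straddle u (c + size u) l))).
  move=> lt_l; transitivity (sumn (map snd (map parikh (cyclic_factors u l)))).
    by apply/perm_sumn/perm_map; rewrite perm_sym permF.
  apply/perm_sumn/perm_map/perm_map.
  (* The [l + 1] windows straddling [c + size u] cover the [l + 1] distinct factors, so the two
     lists agree up to order. *)
  have uniqF : uniq (cyclic_factors u l) := undup_uniq _.
  have subF : {subset cyclic_factors u l <= straddle u (c + size u) l}.
    move=> z; rewrite mem_undup => /mapP [i _ ->].
    have [||t t_in ->] := @straddle_cover u c (c + d) i l _ _ lt_l.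
    - by rewrite va va'.
    - by rewrite size_u subn2 /= vs vs'.
    apply/mapP; exists (t - (c + size u - l)); first by rewrite mem_iota; lia.
    by rewrite subnK //; case/andP: t_in.
  have le_size : size (straddle u (c + size u) l) <= size (cyclic_factors u l).
    by rewrite sizeF // size_map size_iota.
  apply: uniq_perm => //; first exact: leq_size_uniq uniqF subF le_size.
  by case: (uniq_min_size uniqF subF le_size).
(* This is [straddle_sums_eq] at [k * size u] and [c + size u], with positions reduced modulo
   [size u]. *)
have eq_sum t : t < n.+1 ->
    per u (n.+1 - t) + per u t = per u (c + n.+1 - t) + per u (c + t) :> nat.
  move=> lt_t; have := @straddle_sums_eq u _ _ (size u) _ _ sums t.
  rewrite leq_addl leq_pmull; last by lia.
  rewrite size_u => /(_ isT isT lt_t).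
  have -> : k * n.+2 - t.+1 = n.+1 - t + k.-1 * n.+2 by nia.
  rewrite -size_u perDMn -[k * _]add0n addnAC perDMn add0n.
  rewrite addnAC perDn size_u; have -> : c + n.+2 - t.+1 = c + n.+1 - t by lia.
  by [].
have ms : window u 1 n = s.
  rewrite -vs; apply: eq_window => r lt_r.
  have lt_r1 : r.+1 < n.+1 by [].
  (* As [s] is a palindrome, the right side is twice one letter, so both letters on the left equal
     it. *)
  have := eq_sum _ lt_r1; rewrite -(@palindrome_per u c n) ?vs //.
  rewrite add1n addSnnS; do 3!case: (per u _) => //=; lia.
have def_u : u = per u 0 :: rcons s (per u n.+1).
  by rewrite -{1}(window0_id u) size_u windowSS ms.
(* Since [a] and [b] differ, [eq_sum] at 0 says that the end letters of [u] add up to 1. *)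
have ends : (per u 0 = a /\ per u n.+1 = b) \/ (per u 0 = b /\ per u n.+1 = a).
  have := eq_sum 0 isT; rewrite !subn0 addn0 va vb; move: neq_ab.
  by case: (per u 0); case: (per u n.+1); case: (a); case: (b) => //; auto.
apply: Or33; exists s; split=> //.
  move: neq_ab; case: ends => -[u0 un]; rewrite def_u u0 un;
    by case: (a); case: (b) => //; auto.
case: ends => -[u0 un]; rewrite def_u u0 un.
  by exists x, y.
by exists y, x.
Qed.

Theorem theorem3 (u : word) (k : nat) :
  primitive u -> 2 <= k ->
  (strongly_factor_symmetric (word_pow u k) <-> christoffel u).
Proof.
move=> prim_u k_ge2; split; first exact: sfs_christoffel.
exact: christoffel_sfs.
Qed.
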